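(* Let $q\in\{1,2\}$, $\alpha\in(0,1)$, let $n,N\ge1$ be integers, and let $\psi:\widehat{\mathcal Y}\times\widehat{\mathcal Y}\times\mathcal Y\to\mathbb R$ be an antisymmetric comparison function. Assume that either $|\mathcal X|=\infty$ or $|\mathcal Y|=\infty$, and that $\psi$ takes values in $[-B,B]$. Let $\widehat T$ be a black-box test for algorithm comparison, and assume that $\widehat T$ satisfies the stability-constrained validity condition $$\mathbb P_P\big(\widehat T(\mathcal A_0,\mathcal A_1,\mathcal D_N)=1\big)\le\alpha\quad\text{for any }\mathcal A_0,\mathcal A_1,P\text{ such that }\beta_q(\mathcal A_0,\mathcal A_1,P,n)\le\gamma_q\text{ and }\Delta_{P,n}(\mathcal A_0,\mathcal A_1)\le0,$$ for some stability parameter $\gamma_q\ge4B/n^{1/q}$. Then for any algorithms $\mathcal A_0,\mathcal A_1$ and any distribution $P$ on $\mathcal X\times\mathcal Y$ with $\beta_q(\mathcal A_0,\mathcal A_1,P,n)\le\gamma_q$ and $\Delta_{P,n}(\mathcal A_0,\mathcal A_1)>0$, $$\mathbb P_P\big(\widehat T(\mathcal A_0,\mathcal A_1,\mathcal D_N)=1\big)\le\left[\alpha\left(1+\frac{\Delta_{P,n}(\mathcal A_0,\mathcal A_1)+\frac{B(\alpha^{-1}-1)}{N}}{\Delta_P^{\max}-\frac{B(\alpha^{-1}-1)}{N}}\right)^{N/n}\right]\wedge1,$$ provided that $\Delta_P^{\max}>\frac{B(\alpha^{-1}-1)}{N}$.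
   Context: $\mathcal X,\mathcal Y,\widehat{\mathcal Y}$ are measurable spaces; all functions are assumed measurable as appropriate, and singletons $\{(x,y)\}\subset\mathcal X\times\mathcal Y$ are measurable. $a\wedge b=\min(a,b)$; $[n]=\{1,\dots,n\}$. Algorithm: a map $\mathcal A:\bigcup_{m\ge0}(\mathcal X\times\mathcal Y)^m\times[0,1]\to\{\text{measurable functions }\mathcal X\to\widehat{\mathcal Y}\}$, taking a data set (a finite tuple of any size) and a random seed $\xi\in[0,1]$ and returning a fitted model $\mathcal A(\mathcal D;\xi)$; for each $m$ the map $((x_1,y_1),\dots,(x_m,y_m),\xi,x)\mapsto[\mathcal A(\{(x_i,y_i)\}_{i\in[m]};\xi)](x)$ is measurable. No symmetry in the data points is assumed. Comparison function: $\psi$ is antisymmetric, i.e. $\psi(y',y'',y)=-\psi(y'',y',y)$ for all $y\in\mathcal Y$, $y',y''\in\widehat{\mathcal Y}$. For measurable $f_0,f_1:\mathcal X\to\widehat{\mathcal Y}$, $\Delta_P(f_0,f_1)=\mathbb E_P[\psi(f_0(X),f_1(X),Y)]$ with $(X,Y)\sim P$, and $\Delta_P^{\max}=\sup_{f_0,f_1}\Delta_P(f_0,f_1)$. For algorithms, $\Delta_{P,n}(\mathcal A_0,\mathcal A_1)=\mathbb E_P[\Delta_P(\hat f_{0,n},\hat f_{1,n})]$ where $\hat f_{l,n}=\mathcal A_l(\{(X_i,Y_i)\}_{i\in[n]};\xi)$ for $l=0,1$ (same seed for both), $(X_i,Y_i)$ i.i.d. from $P$ and $\xi\sim\mathrm{Unif}[0,1]$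 independent. $\ell_q$-stability of a pair of algorithms: for $(X_1,Y_1),\dots,(X_{n+1},Y_{n+1})$ i.i.d. from $P$, independent $\xi\sim\mathrm{Unif}[0,1]$, $\hat f_{l,n}=\mathcal A_l(\{(X_i,Y_i)\}_{i\in[n]};\xi)$ and $\hat f_{l,n}^{-j}=\mathcal A_l(\{(X_i,Y_i)\}_{i\in[n]\setminus\{j\}};\xi)$ for $l=0,1$, $$\beta_q(\mathcal A_0,\mathcal A_1,P,n)=\max_{j=1,\dots,n}\mathbb E\left[\left|\psi(\hat f_{0,n}(X_{n+1}),\hat f_{1,n}(X_{n+1}),Y_{n+1})-\psi(\hat f_{0,n}^{-j}(X_{n+1}),\hat f_{1,n}^{-j}(X_{n+1}),Y_{n+1})\right|^q\right]^{1/q}.$$ Data: $\mathcal D_N=\{(X_i,Y_i)\}_{i\in[N]}$ with $(X_i,Y_i)$ i.i.d. from $P$. $\mathbb P_P$ is over $\mathcal D_N$ and any randomization in $\widehat T$. Black-box test (algorithm comparison): let $\mathfrak D=\bigcup_{m\ge0}(\mathcal X\times\mathcal Y)^m$. A function $\widehat T$ taking two algorithms $\mathcal A_0,\mathcal A_1$ and a data set $\mathcal D\in\mathfrak D$ and returning a (possibly randomized) output $\widehat T(\mathcal A_0,\mathcal A_1,\mathcal D)\in\{0,1\}$ is a black-box test if, for some functions $g^{(1)},g^{(2)},\dots,g$ (not depending on the algorithms) and random seeds $\zeta^{(1)},\zeta^{(2)},\dots,\zeta$ i.i.d. $\mathrm{Unif}[0,1]$ (independent of the data), it is produced as follows. (1)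 At stage $r=1$, generate a data set in $\mathfrak D$ and a seed in $[0,1]$, $(\mathcal D^{(1)},\xi^{(1)})=g^{(1)}(\mathcal D,\zeta^{(1)})$, and compute $\hat f_l^{(1)}=\mathcal A_l(\mathcal D^{(1)};\xi^{(1)})$ for $l=0,1$. (2) For each stage $r=2,3,\dots$, generate $(\mathcal D^{(r)},\xi^{(r)})=g^{(r)}\big(\mathcal D,(\mathcal D^{(s)})_{1\le s<r},(\hat f_l^{(s)})_{1\le s<r;\,l=0,1},(\zeta^{(s)})_{1\le s\le r},(\xi^{(s)})_{1\le s<r}\big)$ and compute $\hat f_l^{(r)}=\mathcal A_l(\mathcal D^{(r)};\xi^{(r)})$ for $l=0,1$. (3) Repeat until some stopping criterion (evaluated on the information generated so far) is reached; $\hat r$ denotes the data-dependent total number of rounds, which is finite. (4) Return $\widehat T(\mathcal A_0,\mathcal A_1,\mathcal D)=g\big(\mathcal D,(\mathcal D^{(r)})_{1\le r\le\hat r},(\hat f_l^{(r)})_{1\le r\le\hat r;\,l=0,1},(\zeta^{(r)})_{1\le r\le\hat r},(\xi^{(r)})_{1\le r\le\hat r},\zeta\big)$, as a measurable function of $(\mathcal D,\zeta^{(1)},\zeta^{(2)},\dots,\zeta)$. *)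

(* Defs.v *)
From HB Require Import structures.
From mathcomp Require Import all_boot all_order all_algebra.
From mathcomp Require Import all_classical all_reals all_analysis.
From mathcomp Require Import measurable_realfun.

Set Implicit Arguments.
Unset Strict Implicit.
Unset Printing Implicit Defensive.

Import Order.TTheory GRing.Theory Num.Theory.
Import numFieldNormedType.Exports.

Local Open Scope classical_set_scope.
Local Open Scope ring_scope.

Section seeds.
Context (R : realType).

Definition unit_interval : Type := {x : R | 0 <= x <= 1}.

HB.instance Definition _ := Choice.on unit_interval.

Definition unit_interval0 : unit_interval :=
  exist _ 0 (introT andP (conj (lexx 0) ler01)).

HB.instance Definition _ := isPointed.Build unit_interval unit_interval0.

(* [0, 1] with its Borel sets, i.e. the traces of the Borel sets of R. *)
Definition seed : Type :=
  g_sigma_algebra_preimageType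
    (fun u : unit_interval => (sval u : measurableTypeR R)).

Lemma clamp_subproof (x : R) : 0 <= Num.max 0 (Num.min x 1) <= 1.
Proof. by rewrite le_max lexx ge_max ler01 ge_min lexx orbT. Qed.

Definition clamp (x : measurableTypeR R) : seed :=
  exist _ (Num.max 0 (Num.min x 1)) (clamp_subproof x).

Lemma measurable_clamp : measurable_fun [set: measurableTypeR R] clamp.
Proof.
move=> _ _ [B mB <-]; rewrite !setTI -comp_preimage -[X in measurable X]setTI.
rewrite (_ : _ \o _ = fun x : R => Num.max 0 (Num.min x 1))//.
have mm : measurable_fun [set: R] (fun x : R => Num.max 0 (Num.min x 1)).
  by apply: (measurable_maxr (f := cst 0)) => //; apply: (measurable_minr (g := cst 1)).
exact: mm.
Qed.

HB.instance Definition _ := isMeasurableFun.Build _ _ _ _ clamp measurable_clamp.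

(* Unif[0, 1]: the law of U, where U is uniform on [0, 1] as a real random
   variable; the clamp only serves to cast U to the type seed. *)
Definition unif : probability seed R :=
  distribution (uniform_prob (@ltr01 R)) clamp.

(* Sequences of seeds, with the product sigma-algebra. *)
Definition seedseq : Type :=
  g_sigma_algebraType
    [set C : set (nat -> seed) |
      exists (r : nat) (A : set seed), measurable A /\ C = [set z | A (z r)]].

Definition iid_unif (nu : probability seedseq R) :=
  forall (k : nat) (A : nat -> set seed), (forall r, measurable (A r)) ->
    nu [set z : seedseq | forall r, (r < k)%N -> A r (z r)] =
    (\prod_(r < k) unif (A r))%E.

End seeds.

Section iid_sample.
Context d (T : measurableType d) (R : realType).

Definition tuple_cons n (p : T * n.-tuple T) : n.+1.-tuple T :=
  [tuple of p.1 :: p.2].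

Lemma measurable_tuple_cons n : measurable_fun setT (@tuple_cons n).
Proof. exact: measurable_cons. Qed.

HB.instance Definition _ n :=
  isMeasurableFun.Build _ _ _ _ (@tuple_cons n) (@measurable_tuple_cons n).

(* The law of an i.i.d. sample of size n, see iid_box. *)
Fixpoint iid (P : probability T R) (n : nat) : probability (n.-tuple T) R :=
  match n with
  | 0 => dirac [tuple]
  | n'.+1 => distribution (P \x iid P n')%E (@tuple_cons n')
  end.

Lemma iid_box (P : probability T R) n (A : 'I_n -> set T) :
  (forall i, measurable (A i)) ->
  iid P n [set t | forall i, A i (tnth t i)] = (\prod_(i < n) P (A i))%E.
Proof.
elim: n A => [|n IH] A mA /=.
  by rewrite big_ord0 diracE mem_set// => -[].
rewrite big_ord_recl -IH// /distribution /pushforward.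
rewrite (_ : _ @^-1` _ =
    A ord0 `*` [set t | forall i, A (lift ord0 i) (tnth t i)]).
  rewrite product_measure1E//.
  rewrite (_ : [set t | _] =
      \bigcap_(i in [set: 'I_n]) ((fun t => tnth t i) @^-1` A (lift ord0 i))).
    apply: fin_bigcap_measurable => // i _.
    by rewrite -[X in measurable X]setTI; apply: measurable_tnth.
  by apply/seteqP; split=> t h i; [move=> _|]; exact: h.
apply/seteqP; split=> -[x t] /=.
  by move=> h; split=> [|i]; [exact: (h ord0)|move: (h (lift ord0 i)); rewrite tnthS].
move=> [h0 h] i; case: (unliftP ord0 i) => [j|] ->; last exact: h0.
by rewrite tnthS; exact: h.
Qed.

End iid_sample.

Section comparison.
Context (R : realType) (dX dY dZ : measure_display).
Context (X : measurableType dX) (Y : measurableType dY) (Yh : measurableType dZ).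

Record algorithm : Type := Algorithm {
  fit :> seq (X * Y) -> seed R -> {mfun X >-> Yh} ;
  measurable_fit : forall m : nat, measurable_fun setT
    (fun w : (m.-tuple (X * Y) * seed R) * X => fit w.1.1 w.1.2 w.2) }.

Section risk.
Context (psi : Yh -> Yh -> Y -> R) (P : probability (X * Y)%type R).

Definition compare (f0 f1 : X -> Yh) (z : X * Y) : R :=
  psi (f0 z.1) (f1 z.1) z.2.

Definition Delta (f0 f1 : X -> Yh) : R := \int[P]_z compare f0 f1 z.

Definition Delta_max : R := sup [set Delta f0 f1 |
  f0 in [set: {mfun X >-> Yh}] & f1 in [set: {mfun X >-> Yh}]].

Definition Delta_alg (n : nat) (A0 A1 : algorithm) : R :=
  \int[(iid P n \x unif R)%E]_w Delta (A0 w.1 w.2) (A1 w.1 w.2).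

Definition leave_out T (j : nat) (s : seq T) : seq T :=
  take j s ++ drop j.+1 s.

(* The sample point w = ((D, xi), (x, y)) consists of the n training points, the
   seed and the (n+1)-st data point. *)
Definition loo_diff (n : nat) (A0 A1 : algorithm) (j : nat)
    (w : (n.-tuple (X * Y) * seed R) * (X * Y)) : R :=
  compare (A0 w.1.1 w.1.2) (A1 w.1.1 w.1.2) w.2 -
  compare (A0 (leave_out j w.1.1) w.1.2) (A1 (leave_out j w.1.1) w.1.2) w.2.

Definition beta (q n : nat) (A0 A1 : algorithm) : \bar R :=
  (\big[maxe/-oo]_(j < n)
    'N[(iid P n \x unif R) \x P]_(q%:R%:E)[EFin \o loo_diff A0 A1 j])%E.

End risk.

Record round : Type := Round {
  round_data : seq (X * Y) ;
  round_seed : seed R ;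
  round_fit0 : {mfun X >-> Yh} ;
  round_fit1 : {mfun X >-> Yh} ;
  round_zeta : seed R }.

(* query r D h u is g^(r) applied to the data D, to the list h of the r - 1
   earlier rounds, and to u = zeta^(r). *)
Definition query_rule : Type :=
  nat -> seq (X * Y) -> seq round -> seed R -> seq (X * Y) * seed R.

(* The first r rounds. Stages are numbered from 1 and z r is zeta^(r) for
   r >= 1; the entry z 0 is the seed zeta of the final step. *)
Fixpoint transcript (query : query_rule) (A0 A1 : algorithm)
    (D : seq (X * Y)) (z : nat -> seed R) (r : nat) : seq round :=
  match r with
  | 0 => [::]
  | r'.+1 =>
      let h := transcript query A0 A1 D z r' in
      let (Dr, xir) := query r'.+1 D h (z r'.+1) in
      rcons h (Round Dr xir (A0 Dr xir) (A1 Dr xir) (z r'.+1))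
  end.

Definition test : Type :=
  algorithm -> algorithm -> seq (X * Y) -> (nat -> seed R) -> bool.

(* The witness r of the second clause is the total number of rounds. *)
Definition black_box (T : test) : Prop :=
  (forall (A0 A1 : algorithm) (m : nat), measurable_fun setT
     (fun w : m.-tuple (X * Y) * seedseq R => T A0 A1 w.1 w.2)) /\
  exists (query : query_rule) (stop : seq (X * Y) -> seq round -> bool)
    (out : seq (X * Y) -> seq round -> seed R -> bool),
  forall (A0 A1 : algorithm) (D : seq (X * Y)) (z : nat -> seed R),
  let h := transcript query A0 A1 D z in
  exists r : nat,
    [/\ (0 < r)%N, stop D (h r),
        (forall s : nat, (0 < s < r)%N -> ~~ stop D (h s)) &
        T A0 A1 D z = out D (h r) (z 0%N)].

Definition reject_prob (nu : probability (seedseq R) R) (T : test) (N : nat)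
    (P : probability (X * Y)%type R) (A0 A1 : algorithm) : \bar R :=
  ((iid P N \x nu) [set w : N.-tuple (X * Y) * seedseq R | T A0 A1 w.1 w.2])%E.

End comparison.

(* Main.v *)
Require Import Defs.
From HB Require Import structures.
From mathcomp Require Import all_boot all_order all_algebra.
From mathcomp Require Import all_classical all_reals all_analysis.
From mathcomp Require Import measurable_realfun ring lra.

(** Suppose that the pair is rejected with probability [r] above the bound. Fix
    [a < 1] with [a^N] slightly larger than [alpha / r] and a data point [z].
    Contaminate [P] to [P' = a P + (1 - a) delta_z], and poison the two
    algorithms so that a training set containing [z] makes them return fixed
    models [f1], [f0] whose risk gap is close to [- Delta_max], while every
    other training set is treated as before. This pair contradicts validity.

    - The test cannot tell. It only sees fitted models on finitely many queried
      data sets, so among infinitely many candidates for [z] only finitely many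
      affect a given run ([black_box_poisoned]). For a suitable [z] the poisoned
      pair is therefore rejected on data from [P] almost as often as the
      original pair, and [P] itself gives [z] almost no mass.

    - A sample of size [N] from [P'] has law at least [a^N] times the law of a
      sample from [P] ([reject_prob_contaminated]). Since [a^N r > alpha], the
      poisoned pair under [P'] is rejected with probability greater than
      [alpha].

    - Yet the poisoned pair under [P'] meets the hypotheses of validity. With
      probability about [1 - a^n] the training sample contains [z] and the risk
      gap is very negative, which outweighs the gap [Delta_(P,n)] of the
      remaining [a^n] ([Delta_alg_poisoned]); the mass that [P'] puts on [z] as
      a test point costs the terms [B (1/alpha - 1) / N], by Bernoulli's
      inequality. Deleting one training point changes the fits in a new way only
      when that point is the single occurrence of [z], an event of probability
      about [(1 - a) a^(n-1)], and [gamma >= 4 B / n^(1/q)] absorbs this change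
      of size at most [2 B] ([beta_poisoned]).

    A nonpositive risk gap needs [a^n] below the inverse of the base of the power
    in the bound, and the rejection probability needs [a^N] above [alpha / r];
    both are possible at once exactly when [r] exceeds the bound
    ([exists_retention]). All the requirements are then strict
    inequalities, which leaves room for [z] having small positive mass and for
    the supremum [Delta_max] not being attained. *)

Set Implicit Arguments.
Unset Strict Implicit.
Unset Printing Implicit Defensive.

Import Order.TTheory GRing.Theory Num.Theory.
Import numFieldNormedType.Exports.

Local Open Scope classical_set_scope.
Local Open Scope ring_scope.

(** * Elementary inequalities *)

Lemma bernoulli (R : realFieldType) (x : R) n :
  -1 <= x -> 1 + n%:R * x <= (1 + x) ^+ n.
Proof.
move=> x1; elim: n => [|n IH]; first by rewrite mul0r addr0 expr0.
have n0 : 0 <= n%:R * x ^+ 2 by rewrite mulr_ge0// sqr_ge0.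
rewrite exprS -natr1; apply: (@le_trans _ _ ((1 + x) * (1 + n%:R * x))).
  by move: n0; rewrite expr2; nra.
by rewrite ler_wpM2l//; lra.
Qed.

(** These are the first two terms of the binomial expansion of
    [(a + (1 - a)) ^ n.+1 = 1]. *)
Lemma binomial_two_terms_le (R : realFieldType) (a : R) n :
  0 <= a <= 1 -> a ^+ n.+1 + n.+1%:R * (1 - a) * a ^+ n <= 1.
Proof.
move=> /andP[a0 a1]; elim: n => [|n IH]; first by rewrite expr0 expr1; lra.
have q0 : 0 <= a ^+ n.+1 by rewrite exprn_ge0.
have q1 : a ^+ n.+1 <= 1 by rewrite exprn_ile1.
rewrite exprS -[n.+2%:R]natr1 mulrDl mulrDl mul1r.
rewrite (_ : _ + (_ + _) = a * (a ^+ n.+1 + n.+1%:R * (1 - a) * a ^+ n) +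
  (1 - a) * a ^+ n.+1); last by rewrite [in RHS]mulrDr exprS; ring.
nra.
Qed.

(** The stability budget, to the power [q], of a poisoned pair trained on
    [n.+1] points. Here [G] bounds the original instability, [K] is the [q]-th
    power of the largest possible change, [p] the mass of the poisoned point
    under [P], [1 - a + a * p] its mass under the contaminated law, and
    [a * (1 - p)] the mass of its complement. The two terms in [K] are a fresh
    [z] at test time and a single [z] in training. The room comes from the test
    point: it makes the exponent of the first term [n.+2] where the binomial
    expansion needs only [n.+1], and the gain [(1 - a) * a ^+ n.+1] pays for
    [p]. *)
Lemma perturbation_budget (R : realFieldType) (a p K G : R) n :
    0 <= a <= 1 -> 0 <= p <= 1 -> 0 <= K -> 0 <= G ->
    2 * K <= n.+1%:R * G -> n.+1%:R * p <= 1 - a ->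
  a ^+ n.+2 * G + (K * ((1 - a + a * p) * (a * (1 - p)) ^+ n.+1) +
                   K * ((1 - a + a * p) * (a * (1 - p)) ^+ n)) <= G.
Proof.
move=> /andP[a0 a1] /andP[p0 p1] K0 G0 KG np.
set u := a * (1 - p); set c := 1 - a + a * p.
have u0 : 0 <= u by rewrite mulr_ge0// subr_ge0.
have ua : u <= a by rewrite /u ler_piMr// gerBl.
have c0 : 0 <= c by rewrite addr_ge0 ?mulr_ge0// subr_ge0.
have un : u ^+ n <= a ^+ n by rewrite lerXn2r.
have un0 : 0 <= u ^+ n by rewrite exprn_ge0.
have un1 : u ^+ n.+1 <= a ^+ n.
  by rewrite exprS; apply: le_trans un; rewrite ler_piMl//; exact: le_trans a1.
have cu : K * (c * u ^+ n.+1) + K * (c * u ^+ n) <= 2 * K * (c * a ^+ n).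
  rewrite -mulrA mulr_natl mulr2n; apply: lerD; apply: ler_wpM2l => //;
  exact: ler_wpM2l.
have an0 : 0 <= a ^+ n by rewrite exprn_ge0.
have cG : 2 * K * (c * a ^+ n) <= n.+1%:R * G * (c * a ^+ n).
  by rewrite ler_wpM2r// mulr_ge0.
apply: le_trans (_ : a ^+ n.+2 * G + n.+1%:R * G * (c * a ^+ n) <= _).
  by rewrite lerD2l; exact: le_trans cG.
have := @binomial_two_terms_le _ a n; rewrite a0 a1 => /(_ isT) bin.
have npa : n.+1%:R * p * a ^+ n.+1 <= (1 - a) * a ^+ n.+1.
  by rewrite ler_wpM2r// exprn_ge0.
rewrite (_ : _ + _ = (a ^+ n.+2 + (n.+1%:R * (1 - a) * a ^+ n +
    n.+1%:R * p * a ^+ n.+1)) * G).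
  rewrite -[leRHS]mul1r ler_wpM2r//.
  by rewrite [a ^+ n.+2]exprS; lra.
by rewrite /c !exprS; ring.
Qed.

(** The two constraints on [a] confine it between [(alpha / r)^(1/N)] and
    [rho^(-1/n)]; the hypothesis says exactly that this interval is
    nonempty. *)
Lemma exists_retention (R : realType) (alpha r rho : R) n N :
    0 < alpha -> 1 < rho -> (0 < n)%N -> (0 < N)%N ->
    alpha * rho `^ (N%:R / n%:R) < r ->
  exists a, [/\ 0 < a < 1, a ^+ n * rho < 1 & alpha < a ^+ N * r].
Proof.
move=> alpha0 rho1 n0 N0 h.
have rho0 : 0 < rho by exact: lt_trans rho1.
have n0' : 0 < n%:R :> R by rewrite ltr0n.
have N0' : 0 < N%:R :> R by rewrite ltr0n.
have r0 : 0 < r.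
  by apply: le_lt_trans h; rewrite mulr_ge0 ?powR_ge0// ltW.
have ar0 : 0 < alpha / r by rewrite divr_gt0.
pose lo := (alpha / r) `^ N%:R^-1; pose hi := rho `^ (- n%:R^-1).
have lo0 : 0 < lo by rewrite powR_gt0.
have loN : lo ^+ N = alpha / r.
  rewrite -powR_mulrn ?powR_ge0// -powRrM mulVf ?gt_eqF// powRr1//.
  exact: ltW.
have hin : hi ^+ n = rho^-1.
  rewrite -powR_mulrn ?powR_ge0// -powRrM mulNr mulVf ?gt_eqF//.
  by rewrite powR_inv1// ltW.
have hi1 : hi < 1.
  rewrite ltNge; apply/negP => /(exprn_ege1 n); rewrite hin.
  by rewrite leNgt invf_lt1// rho1.
have lohi : lo < hi.
  rewrite -(ltr_pXn2r N0) ?nnegrE ?powR_ge0//.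
  rewrite loN ltr_pdivrMr// -powR_mulrn ?powR_ge0// -powRrM mulNr powRN.
  by rewrite [n%:R^-1 * _]mulrC [ltRHS]mulrC ltr_pdivlMr ?powR_gt0.
exists ((lo + hi) / 2); have ? : lo < (lo + hi) / 2 < hi by lra.
split; first by lra.
- have hin0 : ((lo + hi) / 2) ^+ n < rho^-1.
    by rewrite -hin ltrXn2r// -?lt0n//; lra.
  by rewrite -ltr_pdivlMr// div1r.
- by rewrite -ltr_pdivrMr// -loN ltrXn2r// -?lt0n//; lra.
Qed.

(** * Mixing a distribution with a point mass *)

Section contamination.
Context d (T : measurableType d) (R : realType).
Context (P : probability T R) (z : T) (a : {nonneg R}) (a1 : a%:num <= 1).

Let c : {nonneg R} := NngNum (etrans (subr_ge0 _ _) a1).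

Definition contaminated : set T -> \bar R :=
  measure_add (mscale a P) (mscale c \d_z).

HB.instance Definition _ := Measure.on contaminated.

Let contaminatedT : contaminated setT = 1%E.
Proof.
rewrite /contaminated measure_addE/= /mscale/= probability_setT diracT !mule1.
by rewrite -EFinD addrC subrK.
Qed.

HB.instance Definition _ :=
  Measure_isProbability.Build _ _ _ contaminated contaminatedT.

Lemma ge0_integral_contaminated (F : T -> \bar R) :
    measurable_fun setT F -> (forall x, 0 <= F x)%E ->
  (\int[contaminated]_x F x =
   a%:num%:E * \int[P]_x F x + (1 - a%:num)%:E * F z)%E.
Proof.
move=> mF F0; rewrite ge0_integral_measure_add//.
rewrite !ge0_integral_mscale//= integral_dirac// diracT mul1e//.
Qed.

Lemma contaminatedE (A : set T) :
  contaminated A = (a%:num%:E * P A + (1 - a%:num)%:E * \d_z A)%E.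
Proof. by rewrite /contaminated measure_addE. Qed.

End contamination.

Lemma bounded_integrable d (T : measurableType d) (R : realType)
    (mu : probability T R) (f : T -> R) (M : R) :
    measurable_fun setT f -> (forall x, `|f x| <= M) ->
  mu.-integrable setT (EFin \o f).
Proof.
move=> mf fM; apply: measurable_bounded_integrable => //.
  by rewrite (le_lt_trans (probability_le1 _ _))// ltry.
by exists M; split; [exact: num_real|move=> r Mr w _; apply: le_trans (ltW Mr)].
Qed.

Section iid_contaminated.
Context d (T : measurableType d) (R : realType).

Lemma measurable_fiber_tuple_cons n (F : n.+1.-tuple T -> \bar R) :
    measurable_fun setT F ->
  measurable_fun setT (fun p : T * n.-tuple T => F (tuple_cons p)).
Proof. by move=> mF; apply: measurableT_comp => //; exact: measurable_tuple_cons. Qed.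

Lemma ge0_integral_iidS (P : probability T R) n (F : n.+1.-tuple T -> \bar R) :
    measurable_fun setT F -> (forall t, 0 <= F t)%E ->
  (\int[iid P n.+1]_t F t = \int[P]_x \int[iid P n]_t F (tuple_cons (x, t)))%E.
Proof.
move=> mF F0 /=; rewrite ge0_integral_pushforward//= preimage_setT.
by rewrite fubini_tonelli1//=; exact: measurable_fiber_tuple_cons.
Qed.

Context (P : probability T R) (z : T) (a : {nonneg R}) (a1 : a%:num <= 1).

(** With probability [a ^+ n] none of the [n] points is contaminated, and then
    the sample is an i.i.d. sample from [P]. *)
Lemma ge0_le_integral_iid_contaminated n (F : n.-tuple T -> \bar R) :
    measurable_fun setT F -> (forall t, 0 <= F t)%E ->
  ((a%:num ^+ n)%:E * \int[iid P n]_t F t <=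
   \int[iid (contaminated P z a1) n]_t F t)%E.
Proof.
elim: n F => [|n IH] F mF F0; first by rewrite expr0 mul1e.
have mG (Q : probability T R) :
    measurable_fun setT (fun x => \int[iid Q n]_t F (tuple_cons (x, t)))%E.
  apply: (@measurable_fun_fubini_tonelli_F _ _ _ _ _ (iid Q n)
    (fun p => F (tuple_cons p))) => //.
  exact: measurable_fiber_tuple_cons.
have mc x : measurable_fun setT (fun t => F (tuple_cons (x, t))).
  exact: measurableT_comp (measurable_fiber_tuple_cons mF) (measurable_pair1 x).
rewrite !ge0_integral_iidS// ge0_integral_contaminated//; last first.
  by move=> x; apply: integral_ge0.
rewrite exprSr EFinM muleAC muleC; apply: (@le_trans _ _ (a%:num%:E *
    \int[P]_x \int[iid (contaminated P z a1) n]_t F (tuple_cons (x, t)))%E).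
  apply: lee_wpmul2l; first by rewrite lee_fin.
  rewrite -ge0_integralZl//.
  - apply: ge0_le_integral => //.
    + by move=> x _; rewrite mule_ge0 ?lee_fin ?exprn_ge0// integral_ge0.
    + exact: measurable_funeM.
    + by move=> x _; exact: IH.
  - by move=> x _; exact: integral_ge0.
rewrite leeDl// mule_ge0 ?integral_ge0//.
by rewrite lee_fin subr_ge0.
Qed.

(** A sample that avoids [z] has no contaminated point, so on such samples the
    previous bound is an equality. *)
Lemma ge0_integral_iid_contaminated n (F : n.-tuple T -> \bar R) :
    measurable_fun setT F -> (forall t, 0 <= F t)%E ->
    (forall t : n.-tuple T, z \in t -> F t = 0%E) ->
  (\int[iid (contaminated P z a1) n]_t F t =
   (a%:num ^+ n)%:E * \int[iid P n]_t F t)%E.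
Proof.
elim: n F => [|n IH] F mF F0 Fz; first by rewrite expr0 mul1e.
have mG (Q : probability T R) :
    measurable_fun setT (fun x => \int[iid Q n]_t F (tuple_cons (x, t)))%E.
  apply: (@measurable_fun_fubini_tonelli_F _ _ _ _ _ (iid Q n)
    (fun p => F (tuple_cons p))) => //.
  exact: measurable_fiber_tuple_cons.
have mc x : measurable_fun setT (fun t => F (tuple_cons (x, t))).
  exact: measurableT_comp (measurable_fiber_tuple_cons mF) (measurable_pair1 x).
rewrite !ge0_integral_iidS// ge0_integral_contaminated//; last first.
  by move=> x; apply: integral_ge0.
rewrite [X in ((1 - _)%:E * X)%E]integral0_eq ?mule0 ?adde0; last first.
  by move=> t _; rewrite Fz// inE eqxx.
rewrite exprS EFinM -muleA; congr (_ * _)%E.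
rewrite -ge0_integralZl//.
- apply: eq_integral => x _; apply: IH => // t zt.
  by rewrite Fz// inE zt orbT.
- by move=> x _; exact: integral_ge0.
Qed.

Context d' (U : measurableType d') (nu : probability U R).

Lemma ge0_le_integral_iid_contaminated_prod n (F : n.-tuple T * U -> \bar R) :
    measurable_fun setT F -> (forall w, 0 <= F w)%E ->
  ((a%:num ^+ n)%:E * \int[(iid P n \x nu)%E]_w F w <=
   \int[(iid (contaminated P z a1) n \x nu)%E]_w F w)%E.
Proof.
move=> mF F0; rewrite !fubini_tonelli1//.
apply: ge0_le_integral_iid_contaminated.
  exact: measurable_fun_fubini_tonelli_F.
by move=> t; exact: integral_ge0.
Qed.

Lemma ge0_integral_iid_contaminated_prod n (F : n.-tuple T * U -> \bar R) :
    measurable_fun setT F -> (forall w, 0 <= F w)%E ->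
    (forall w, z \in w.1 -> F w = 0%E) ->
  (\int[(iid (contaminated P z a1) n \x nu)%E]_w F w =
   (a%:num ^+ n)%:E * \int[(iid P n \x nu)%E]_w F w)%E.
Proof.
move=> mF F0 Fz; rewrite !fubini_tonelli1//.
apply: ge0_integral_iid_contaminated.
- exact: measurable_fun_fubini_tonelli_F.
- by move=> t; exact: integral_ge0.
- by move=> t zt; apply: integral0_eq => u _; exact: Fz.
Qed.

(** Signed version, needed because risk gaps take both signs; the bound on [f]
    makes the two parts of the integral finite. *)
Lemma Rintegral_iid_contaminated_prod n (f : n.-tuple T * U -> R) :
    measurable_fun setT f ->
    (exists M, forall w, `|f w| <= M) ->
    (forall w, z \in w.1 -> f w = 0) ->
  \int[(iid (contaminated P z a1) n \x nu)%E]_w f w =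
  a%:num ^+ n * \int[(iid P n \x nu)%E]_w f w.
Proof.
move=> mf [M fM] fz.
have mF : measurable_fun setT (EFin \o f) by exact/measurable_EFinP.
have intf : (iid P n \x nu)%E.-integrable setT (EFin \o f).
  exact: bounded_integrable mf fM.
rewrite /Rintegral -[a%:num ^+ n]/(fine (a%:num ^+ n)%:E) -fineM//; last first.
  exact: integrable_fin_num.
congr fine; rewrite integralE [in RHS]integralE muleBr//; last first.
  apply: fin_num_adde_defl.
  rewrite fin_numN; apply: integrable_fin_num => //.
  exact: integrable_funeneg.
congr (_ - _)%E; apply: ge0_integral_iid_contaminated_prod => //.
- exact: measurable_funepos.
- by move=> w /fz fw; rewrite funeposE/= fw maxxx.
- exact: measurable_funeneg.
- by move=> w /fz fw; rewrite funenegE/= fw oppr0 maxxx.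
Qed.

End iid_contaminated.

(** * Occurrences of a point in an i.i.d. sample *)

Section occurrences.
Context d (T : measurableType d) (R : realType) (z : T) (mz : measurable [set z]).

Lemma measurable_mem_tuple n :
  measurable_fun setT (fun t : n.-tuple T => z \in t).
Proof.
apply: (measurable_fun_bool true); rewrite setTI.
rewrite (_ : _ @^-1` _ =
    \bigcup_(i in [set: 'I_n]) ((fun t => tnth t i) @^-1` [set z])).
  apply: fin_bigcup_measurable => // i _.
  by rewrite -[X in measurable X]setTI; apply: measurable_tnth.
apply/seteqP; split=> [t /tnthP[i ->]|t [i _ /= <-]]; first by exists i.
exact: mem_tnth.
Qed.

Lemma measurable_notin n : measurable [set t : n.-tuple T | z \notin t].
Proof.
rewrite -[X in measurable X]setTI.
rewrite (_ : mkset _ = (fun t : n.-tuple T => z \in t) @^-1` [set false]).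
  exact: measurable_mem_tuple.
by apply/seteqP; split=> t /=; [move/negPf|move/negbT].
Qed.

Lemma iid_notin (Q : probability T R) n (r : R) :
    Q (~` [set z]) = r%:E ->
  iid Q n [set t : n.-tuple T | z \notin t] = (r ^+ n)%:E.
Proof.
move=> Qz; rewrite (_ : [set t | _] = [set t | forall i, (~` [set z]) (tnth t i)]).
  rewrite (iid_box Q (A := fun=> ~` [set z])); last by move=> i; exact: measurableC.
  by under eq_bigr do rewrite Qz; rewrite prodEFin prodr_const card_ord.
apply/seteqP; split=> [t /= zt i /= ti|t /= zt]; first by rewrite -ti mem_tnth in zt.
by apply/negP => /tnthP[i zi]; apply: (zt i).
Qed.

Lemma measurable_once n (j : 'I_n) :
  measurable [set t : n.-tuple T | forall i, (tnth t i == z) = (i == j)].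
Proof.
rewrite (_ : mkset _ = \bigcap_(i in [set: 'I_n]) ((fun t => tnth t i) @^-1`
    (if i == j then [set z] else ~` [set z]))); last first.
  apply/seteqP; split=> [t h i _|t h i]; [have := h i|have := h i Logic.I] => /=.
    by case: ifP => _ /=; [move/eqP|move/negbT/eqP].
  by case: ifP => _ /=; [move/eqP|move/eqP/negPf].
apply: fin_bigcap_measurable => // i _.
rewrite -[X in measurable X]setTI; apply: measurable_tnth => //.
by case: ifP => // _; exact: measurableC.
Qed.

Lemma iid_once (Q : probability T R) n (j : 'I_n) (s r : R) :
    Q [set z] = s%:E -> Q (~` [set z]) = r%:E ->
  iid Q n [set t | forall i, (tnth t i == z) = (i == j)] = (s * r ^+ n.-1)%:E.
Proof.
move=> Qz Qz'; pose A i := if i == j then [set z] else ~` [set z].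
rewrite (_ : [set t | _] = [set t | forall i, A i (tnth t i)]).
  rewrite (iid_box Q (A := A)); last first.
    by move=> i; rewrite /A; case: ifP => // _; exact: measurableC.
  rewrite (bigD1 j)//= {1}/A eqxx Qz EFinM; congr (_ * _)%E.
  rewrite (eq_bigr (fun=> r%:E)); last by move=> i /negPf ij; rewrite /A ij.
  by rewrite prodEFin prodr_const cardC1 card_ord.
apply/seteqP; split=> t /= h i; have := h i; rewrite /A.
  by case: ifP => _ /=; [move/eqP|move/negbT/eqP].
by case: ifP => _ /=; [move/eqP|move/eqP/negPf].
Qed.

End occurrences.

(** * Poisoned algorithms and the blind spot of black-box tests *)

Section poisoned_algorithm.
Context (R : realType) (dX dY dZ : measure_display).
Context (X : measurableType dX) (Y : measurableType dY) (Yh : measurableType dZ).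
Context (z : X * Y) (mz : measurable [set z]) (f : {mfun X >-> Yh}).

Definition poisoned_fit (A : algorithm R X Y Yh) (s : seq (X * Y)) (xi : seed R) :=
  if z \in s then f else A s xi.

Lemma measurable_poisoned_fit A m : measurable_fun setT
  (fun w : (m.-tuple (X * Y) * seed R) * X => poisoned_fit A w.1.1 w.1.2 w.2).
Proof.
rewrite (_ : (fun w => _) = (fun w : (m.-tuple (X * Y) * seed R) * X =>
    if z \in w.1.1 then f w.2 else A w.1.1 w.1.2 w.2)); last first.
  by apply/funext => w; rewrite /poisoned_fit; case: ifP.
apply: measurable_fun_ifT.
- apply: (measurableT_comp (measurable_mem_tuple mz (n := m))).
  exact: (measurableT_comp measurable_fst measurable_fst).
- exact: (measurableT_comp (measurable_funPT f) measurable_snd).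
- exact: measurable_fit.
Qed.

Definition poisoned (A : algorithm R X Y Yh) : algorithm R X Y Yh :=
  Algorithm (measurable_poisoned_fit A).

End poisoned_algorithm.

Section black_box_blind_spot.
Context (R : realType) (dX dY dZ : measure_display).
Context (X : measurableType dX) (Y : measurableType dY) (Yh : measurableType dZ).

(** The poisoned algorithms return literally the same models as the original
    ones as long as [z] is never queried, so the rounds coincide by
    induction. *)
Lemma transcript_poisoned (query : query_rule R X Y Yh) A0 A1 D zeta
    (z : X * Y) (mz : measurable [set z]) f0 f1 r :
    (forall rd, rd \in map (@round_data _ _ _ _ _ _ _)
       (transcript query A0 A1 D zeta r) -> z \notin rd) ->
  transcript query (poisoned mz f0 A0) (poisoned mz f1 A1) D zeta r =
  transcript query A0 A1 D zeta r.
Proof.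
elim: r => //= r IH.
case E : (query r.+1 D (transcript query A0 A1 D zeta r) (zeta r.+1)) => [Dr xir].
rewrite map_rcons => h; rewrite IH; last first.
  by move=> rd rdin; apply: h; rewrite mem_rcons inE rdin orbT.
have /negPf zD : z \notin Dr by apply: h; rewrite mem_rcons mem_head.
by rewrite E /= /poisoned_fit zD.
Qed.

(** A run is fixed by finitely many finite data sets, and an injective sequence
    of points meets a finite set only finitely often. The statement is pointwise
    in the data and the seeds: the event that [z k] is queried need not be
    measurable, as the query rule is arbitrary. *)
Lemma black_box_poisoned (T : test R X Y Yh) A0 A1 D zeta (z : nat -> X * Y)
    (mz : forall k, measurable [set z k]) f0 f1 :
    black_box T -> injective z ->
  \forall k \near \oo,
    T (poisoned (mz k) f0 A0) (poisoned (mz k) f1 A1) D zeta = T A0 A1 D zeta.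
Proof.
move=> [_ [query [stop [out h]]]] zinj.
have [r [r0 stopr minr Tr]] := h A0 A1 D zeta.
set seen := flatten (map (@round_data _ _ _ _ _ _ _)
  (transcript query A0 A1 D zeta r)).
have [K HK] : exists K, forall k, (K <= k)%N -> z k \notin seen.
  elim: seen => [|y s [K HK]]; first by exists 0%N.
  have [[k0 zk0]|nk] := pselect (exists k, z k = y); last first.
    exists K => k Kk; rewrite inE negb_or HK// andbT.
    by apply/eqP => zk; apply: nk; exists k.
  exists (maxn K k0.+1) => k; rewrite geq_max => /andP[Kk k0k].
  rewrite inE negb_or HK// andbT -zk0; apply/eqP => /zinj kk0.
  by rewrite kk0 ltnn in k0k.
exists K => // k /= Kk; set B0 := poisoned _ _ _; set B1 := poisoned _ _ _.
have same s : (s <= r)%N ->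
    transcript query B0 B1 D zeta s = transcript query A0 A1 D zeta s.
  move=> sr; apply: transcript_poisoned => rd rdin.
  apply: contra (HK k Kk) => zrd; apply/flattenP; exists rd => //.
  have : {subset map (@round_data _ _ _ _ _ _ _) (transcript query A0 A1 D zeta s)
      <= map (@round_data _ _ _ _ _ _ _) (transcript query A0 A1 D zeta r)}.
    elim: r sr {r0 stopr minr Tr seen HK} => [|r IH]; first by rewrite leqn0 => /eqP ->.
    rewrite leq_eqVlt => /predU1P[->//|/IH sub] x /sub xin /=.
    by case: (query _ _ _ _) => ? ?; rewrite map_rcons mem_rcons inE xin orbT.
  exact.
have [r' [r'0 stopr' minr' Tr']] := h B0 B1 D zeta.
(* The transcripts agree up to round [r], hence so do the stopping times. *)
have r'r : r' = r.
  case: (ltngtP r' r) => // [lt|lt].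
    have := minr r'; rewrite r'0 lt => /(_ isT).
    by rewrite -(same _ (ltnW lt)) stopr'.
  by have := minr' r; rewrite r0 lt => /(_ isT); rewrite same// stopr.
by rewrite Tr' Tr r'r same.
Qed.

End black_box_blind_spot.

(** Continuity from below turns an eventual inclusion that holds point by point,
    without uniformity, into a bound on the measures. *)
Lemma near_lt_measure d (T : measurableType d) (R : realType)
    (mu : {measure set T -> \bar R}) (S : set T) (F : (set T)^nat) (r : \bar R) :
    measurable S -> (forall k, measurable (F k)) ->
    (forall x, S x -> \forall k \near \oo, F k x) ->
    (r < mu S)%E ->
  \forall k \near \oo, (r < mu (F k))%E.
Proof.
move=> mS mF SF rS; pose G k := S `&` \bigcap_(i in [set i | (k <= i)%N]) F i.
have mG k : measurable (G k).
  by apply: measurableI => //; apply: bigcap_measurable => //; exists k => /=.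
have GS : \bigcup_k G k = S.
  apply/seteqP; split=> [x [k _ []]//|x Sx].
  by have [k _ Fk] := SF x Sx; exists k => //; split.
have ndG : nondecreasing_seq G.
  move=> m n mn; apply/subsetPset => x [Sx Gx]; split=> // i /= ni.
  by apply: Gx => /=; exact: leq_trans ni.
have := nondecreasing_cvg_mu (mu := mu) mG; rewrite GS => /(_ mS ndG) cvg.
have [K _ GK] := cvg _ (open_ereal_gt' rS).
exists K => // k /= /GK /lt_le_trans; apply.
by apply: le_measure; rewrite ?inE// => x [_ Gx]; apply: Gx => /=.
Qed.

(** * Risk of a poisoned pair *)

Section risk.
Context (R : realType) (dX dY dZ : measure_display).
Context (X : measurableType dX) (Y : measurableType dY) (Yh : measurableType dZ).
Context (psi : Yh -> Yh -> Y -> R) (B : R).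
Context (psi_measurable :
  measurable_fun setT (fun w : Yh * Yh * Y => psi w.1.1 w.1.2 w.2)).
Context (psi_bounded : forall y' y'' y, - B <= psi y' y'' y <= B).

Lemma normr_compare_le f0 f1 (z : X * Y) : `|compare psi f0 f1 z| <= B.
Proof. by rewrite ler_norml; exact: psi_bounded. Qed.

Lemma measurable_compare (f0 f1 : {mfun X >-> Yh}) :
  measurable_fun setT (compare psi f0 f1 : X * Y -> R).
Proof.
apply: (measurableT_comp psi_measurable
  (g := fun z : X * Y => ((f0 z.1, f1 z.1), z.2))).
apply: measurable_fun_pair => //; apply: measurable_fun_pair.
  exact: (measurableT_comp (measurable_funPT f0) measurable_fst).
exact: (measurableT_comp (measurable_funPT f1) measurable_fst).
Qed.

Lemma measurable_compare_fit (A0 A1 : algorithm R X Y Yh) m : measurable_fun setT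
  (fun w : (m.-tuple (X * Y) * seed R) * (X * Y) =>
     compare psi (A0 w.1.1 w.1.2) (A1 w.1.1 w.1.2) w.2).
Proof.
have mw : measurable_fun setT (fun w : (m.-tuple (X * Y) * seed R) * (X * Y) =>
    (w.1, w.2.1)).
  apply: measurable_fun_pair => //.
  exact: (measurableT_comp measurable_fst measurable_snd).
apply: (measurableT_comp psi_measurable
  (g := fun w : (m.-tuple (X * Y) * seed R) * (X * Y) =>
    ((A0 w.1.1 w.1.2 w.2.1, A1 w.1.1 w.1.2 w.2.1), w.2.2))).
apply: measurable_fun_pair; last exact: (measurableT_comp measurable_snd measurable_snd).
apply: measurable_fun_pair.
  exact: (measurableT_comp (measurable_fit A0 (m:=m)) mw).
exact: (measurableT_comp (measurable_fit A1 (m:=m)) mw).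
Qed.

Lemma Rintegral_cst_probability d (T : measurableType d) (mu : probability T R) (r : R) :
  \int[mu]_x r = r.
Proof. by rewrite /Rintegral/= integral_cst//= probability_setT mule1. Qed.

(** Shifting by the bound makes the integrand nonnegative, so that the
    nonnegative integration lemmas apply to risks. *)
Lemma integral_compareD (P : probability (X * Y)%type R) (f0 f1 : {mfun X >-> Yh}) :
  (\int[P]_z (compare psi f0 f1 z + B)%:E = (Delta psi P f0 f1 + B)%:E)%E.
Proof.
have icmp : P.-integrable setT (EFin \o compare psi f0 f1).
  exact: bounded_integrable _ (measurable_compare f0 f1) (normr_compare_le f0 f1).
have iB : P.-integrable setT (EFin \o (fun=> B)).
  by apply: (bounded_integrable _ (M := `|B|)).
rewrite (_ : Delta psi P f0 f1 + B = \int[P]_z (compare psi f0 f1 z + B)); last first.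
  by rewrite RintegralD// Rintegral_cst_probability.
rewrite /Rintegral fineK//.
apply: integrable_fin_num => //.
apply: (bounded_integrable _ (M := `|B| + `|B|)).
  by apply: measurable_funD => //; exact: measurable_compare.
move=> z; apply: le_trans (ler_normD _ _) _; apply: lerD => //.
by apply: le_trans (normr_compare_le f0 f1 z) (ler_norm _).
Qed.

Lemma measurable_Delta_fit (P : probability (X * Y)%type R)
    (A0 A1 : algorithm R X Y Yh) m : measurable_fun setT
  (fun w : m.-tuple (X * Y) * seed R => Delta psi P (A0 w.1 w.2) (A1 w.1 w.2)).
Proof.
rewrite (_ : (fun w => _) = (fun w : m.-tuple (X * Y) * seed R =>
  fine (\int[P]_z (compare psi (A0 w.1 w.2) (A1 w.1 w.2) z + B)%:E)%E - B)); last first.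
  by apply/funext => w; rewrite integral_compareD/= addrK.
apply: measurable_funB => //; apply: (measurableT_comp (f := fine)) => //.
apply: (@measurable_fun_fubini_tonelli_F _ _ _ _ _ P
  (fun w : (m.-tuple (X * Y) * seed R) * (X * Y) =>
    (compare psi (A0 w.1.1 w.1.2) (A1 w.1.1 w.1.2) w.2 + B)%:E)).
  apply/measurable_EFinP; apply: measurable_funD => //.
  exact: measurable_compare_fit.
move=> w; rewrite lee_fin -lerBlDr sub0r.
by case/andP: (psi_bounded (A0 w.1.1 w.1.2 w.2.1) (A1 w.1.1 w.1.2 w.2.1) w.2.2).
Qed.

Lemma normr_Delta_le (P : probability (X * Y)%type R) (f0 f1 : {mfun X >-> Yh}) :
  `|Delta psi P f0 f1| <= B.
Proof.
have icmp : P.-integrable setT (EFin \o compare psi f0 f1).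
  exact: bounded_integrable _ (measurable_compare f0 f1) (normr_compare_le f0 f1).
rewrite -[leRHS](Rintegral_cst_probability P).
apply: le_trans (le_normr_Rintegral _ icmp) _ => //.
apply: le_Rintegral => //; last by move=> z _; exact: normr_compare_le.
  apply: (bounded_integrable _ (M := B)).
    by apply: measurableT_comp => //; exact: measurable_compare.
  by move=> z; rewrite normr_id normr_compare_le.
exact: (bounded_integrable _ (M := `|B|)).
Qed.

Lemma Delta_anti (P : probability (X * Y)%type R) (f0 f1 : {mfun X >-> Yh}) :
    (forall y' y'' y, psi y' y'' y = - psi y'' y' y) ->
  Delta psi P f1 f0 = - Delta psi P f0 f1.
Proof.
move=> anti; rewrite -mulN1r /Delta -RintegralZl//; last first.
  exact: bounded_integrable _ (measurable_compare f0 f1) (normr_compare_le f0 f1).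
by apply: eq_Rintegral => w _; rewrite mulN1r /compare anti.
Qed.

Context (P : probability (X * Y)%type R) (z : X * Y) (mz : measurable [set z]).
Context (a : {nonneg R}) (a1 : a%:num <= 1).

(** The contaminated test point contributes at most [B]. *)
Lemma Delta_contaminated (f0 f1 : {mfun X >-> Yh}) :
  Delta psi (contaminated P z a1) f0 f1 <=
  a%:num * Delta psi P f0 f1 + (1 - a%:num) * B.
Proof.
have mc := measurable_compare f0 f1.
have c0 w : (0 <= (compare psi f0 f1 w + B)%:E)%E.
  rewrite lee_fin -lerBlDr sub0r.
  by case/andP: (psi_bounded (f0 w.1) (f1 w.1) w.2).
have mcB : measurable_fun setT (fun w : X * Y => (compare psi f0 f1 w + B)%:E).
  by apply/measurable_EFinP; exact: measurable_funD.
have := ge0_integral_contaminated P z a1 mcB c0.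
rewrite !integral_compareD -!EFinM -EFinD => -[].
have : compare psi f0 f1 z <= B by apply: le_trans (normr_compare_le _ _ _); exact: ler_norm.
move=> /(ler_wpM2l (_ : 0 <= 1 - a%:num)); rewrite subr_ge0 => /(_ a1).
nra.
Qed.

(** If [z] is in the training sample the risk gap under [P] is [- D], where
    [D = Delta psi P f0 f1]; so [D] plus the gap vanishes on such samples, and
    its integral over contaminated samples is [a ^+ n] times its integral over
    clean ones. The term [B * (n%:R * p)] accounts for clean samples that happen
    to contain [z]. *)
Lemma Delta_alg_poisoned (p : R) (n : nat) (A0 A1 : algorithm R X Y Yh)
    (f0 f1 : {mfun X >-> Yh}) :
    (forall y' y'' y, psi y' y'' y = - psi y'' y' y) ->
    0 <= Delta psi P f0 f1 -> P (~` [set z]) = (1 - p)%:E -> 0 <= p <= 1 ->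
  Delta_alg psi (contaminated P z a1) n (poisoned mz f1 A0) (poisoned mz f0 A1) <=
  (1 - a%:num) * B - a%:num * Delta psi P f0 f1 +
  a%:num ^+ n.+1 * (Delta_alg psi P n A0 A1 + Delta psi P f0 f1 + B * (n%:R * p)).
Proof.
move=> anti; set D := Delta psi P f0 f1 => D0 Pz p01.
set A0' := poisoned mz f1 A0; set A1' := poisoned mz f0 A1.
pose h (w : n.-tuple (X * Y) * seed R) := Delta psi P (A0 w.1 w.2) (A1 w.1 w.2).
pose h' (w : n.-tuple (X * Y) * seed R) := Delta psi P (A0' w.1 w.2) (A1' w.1 w.2).
pose e (w : n.-tuple (X * Y) * seed R) : R := if z \in w.1 then 1 else 0.
have mh : measurable_fun setT h by exact: measurable_Delta_fit.
have mh' : measurable_fun setT h' by exact: measurable_Delta_fit.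
have nDB : `|D| <= B by exact: normr_Delta_le.
have DB : D <= B by apply: le_trans (ler_norm _) nDB.
have B0 : 0 <= B by exact: le_trans DB.
have hB w : `|h w| <= B by exact: normr_Delta_le.
have h'B w : `|h' w| <= B by exact: normr_Delta_le.
have me : measurable_fun setT e.
  apply: measurable_fun_ifT => //.
  exact: (measurableT_comp (measurable_mem_tuple mz (n := n)) measurable_fst).
have e1 w : `|e w| <= 1 by rewrite /e; case: ifP; rewrite ?normr0 ?normr1.
have mh'D : measurable_fun setT (fun w => h' w + D) by exact: measurable_funD.
have h'DB w : `|h' w + D| <= B + B.
  apply: le_trans (ler_normD _ _) _; exact: lerD.
have h'z w : z \in w.1 -> h' w = - D.
  by move=> zw; rewrite /h' /A0' /A1' /= /poisoned_fit zw; exact: Delta_anti.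
clearbody D.
pose mu : probability (n.-tuple (X * Y) * seed R)%type R := (iid P n \x unif R)%E.
pose mu' : probability (n.-tuple (X * Y) * seed R)%type R :=
  (iid (contaminated P z a1) n \x unif R)%E.
have intb (m : probability _ R) (f : n.-tuple (X * Y) * seed R -> R) M :=
  @bounded_integrable _ _ R m f M.
have step1 : Delta_alg psi (contaminated P z a1) n A0' A1' <=
    (1 - a%:num) * B - a%:num * D + a%:num * \int[mu']_w (h' w + D).
  rewrite -[X in _ <= X + _](Rintegral_cst_probability mu').
  rewrite -RintegralZl//; last exact: (intb _ _ _ _ h'DB).
  rewrite -RintegralD//; last 2 first.
  - exact: (intb _ _ `|(1 - a%:num) * B - a%:num * D|).
  - apply: (intb _ _ (`|a%:num| * (B + B))); first exact: measurable_funM.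
    by move=> w; rewrite normrM ler_wpM2l.
  apply: le_Rintegral => //.
  - apply: (intb _ _ B); first exact: measurable_Delta_fit.
    by move=> w; exact: normr_Delta_le.
  - apply: (intb _ _ (`|(1 - a%:num) * B - a%:num * D| + `|a%:num| * (B + B))).
      by apply: measurable_funD => //; exact: measurable_funM.
    move=> w; apply: le_trans (ler_normD _ _) _; apply: lerD => //.
    by rewrite normrM ler_wpM2l.
  move=> w _; apply: le_trans (Delta_contaminated _ _) _.
  by rewrite -/(h' w) mulrDr; lra.
have step2 : \int[mu']_w (h' w + D) = a%:num ^+ n * \int[mu]_w (h' w + D).
  apply: Rintegral_iid_contaminated_prod => //; first by exists (B + B).
  by move=> w /h'z ->; rewrite addNr.
have step3 : \int[mu]_w (h' w + D) <= Delta_alg psi P n A0 A1 + D + B * \int[mu]_w e w.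
  rewrite -[D in leRHS](Rintegral_cst_probability mu).
  rewrite -RintegralZl//; last exact: (intb _ _ _ _ e1).
  rewrite -RintegralD//; last 2 first.
  - exact: (intb _ _ _ _ hB).
  - exact: (intb _ _ `|D|).
  have mBe : measurable_fun setT (fun w => B * e w) by exact: measurable_funM.
  have Bew w : `|B * e w| <= B * 1 by rewrite normrM ger0_norm// ler_wpM2l.
  have mhD : measurable_fun setT (fun w => h w + D) by exact: measurable_funD.
  have hDw w : `|h w + D| <= B + B.
    apply: le_trans (ler_normD _ _) _; exact: lerD.
  rewrite -RintegralD//; last 2 first.
  - exact: (intb _ _ _ _ hDw).
  - exact: (intb _ _ _ _ Bew).
  apply: le_Rintegral => //; first exact: (intb _ _ _ _ h'DB).
    apply: (intb _ _ (B + B + B * 1)); first exact: measurable_funD.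
    move=> w; apply: le_trans (ler_normD _ _) _.
    exact: (lerD (hDw w) (Bew w)).
  move=> w _; rewrite -/(h w) /e; case: ifPn => zw.
    rewrite h'z// addNr mulr1; have := hB w; rewrite ler_norml => /andP[? ?]; lra.
  rewrite mulr0 addr0 lerD2r /h' /A0' /A1' /= /poisoned_fit (negbTE zw).
  exact: lexx.
have step4 : \int[mu]_w e w <= n%:R * p.
  pose N := [set t : n.-tuple (X * Y) | z \notin t].
  have mN : measurable N by exact: measurable_notin.
  have -> : \int[mu]_w e w = fine (mu (~` N `*` setT)).
    rewrite /Rintegral -(setIT (_ `*` _)) -integral_indic//; last first.
      by apply: measurableX => //; exact: measurableC.
    congr fine; apply: eq_integral => w _; rewrite indicE /e; congr EFin.
    have -> : (w \in ~` N `*` setT) = (z \in w.1); last by case: ifP.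
    by apply/idP/idP; rewrite inE /N /=; [case=> /negP; rewrite negbK|
      move=> zw; split=> //; apply/negP; rewrite negbK].
  have -> : mu (~` N `*` setT) = (iid P n (~` N) * unif R setT)%E.
    by apply: product_measure1E => //; exact: measurableC.
  rewrite probability_setT mule1 probability_setC// (iid_notin mz n Pz).
  rewrite -EFinB/= lerBlDl -lerBlDr -mulrN; apply: bernoulli.
  by rewrite lerN2; case/andP: p01.
apply: le_trans step1 _; rewrite lerD2l step2 exprS -mulrA ler_wpM2l//.
rewrite ler_wpM2l ?exprn_ge0//; apply: le_trans step3 _.
by rewrite lerD2l ler_wpM2l.
Qed.

End risk.

(** * Leaving one point out *)

Section leave_one_out.

(** [leave_out] with its length in the type, so that measurability makes
    sense. *)
Definition leave_out_tuple (T : Type) n (j : 'I_n.+1) (t : n.+1.-tuple T) : n.-tuple T :=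
  [tuple tnth t (lift j i) | i < n].

Lemma leave_out_tupleE (T : Type) n (j : 'I_n.+1) (t : n.+1.-tuple T) :
  leave_out_tuple j t = leave_out j t :> seq T.
Proof.
have jn : (j < size t)%N by rewrite size_tuple.
have sz : size (leave_out j t) = n.
  by rewrite /leave_out size_cat size_take size_drop jn size_tuple subnS subSKn subnKC// -ltnS.
apply: (@eq_from_nth _ (tnth t j)); first by rewrite size_tuple sz.
move=> i; rewrite size_tuple => i_n.
rewrite -[i]/(nat_of_ord (Ordinal i_n)) -tnth_nth tnth_mktuple.
rewrite (tnth_nth (tnth t j)) /leave_out nth_cat size_take jn /= /bump leqNgt.
case: ltnP => ij /=; first by rewrite add0n nth_take.
by rewrite nth_drop add1n addSn subnKC.
Qed.

Lemma measurable_leave_out d (T : measurableType d) n (j : 'I_n.+1) :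
  measurable_fun setT (@leave_out_tuple T n j).
Proof.
apply/measurable_fun_tnthP => i.
rewrite (_ : _ \o _ = fun t => tnth t (lift j i)); first exact: measurable_tnth.
by apply/funext => t /=; rewrite tnth_mktuple.
Qed.

Lemma mem_leave_out (T : eqType) n (j : 'I_n.+1) (t : n.+1.-tuple T) x :
  x \in leave_out j t -> x \in t.
Proof.
by rewrite -leave_out_tupleE => /tnthP[i ->]; rewrite tnth_mktuple mem_tnth.
Qed.

(** The only way to lose [x] by deleting one entry is that it occurred there and
    nowhere else. *)
Lemma notin_leave_out (T : eqType) n (j : 'I_n.+1) (t : n.+1.-tuple T) x :
  x \in t -> x \notin leave_out j t -> forall i, (tnth t i == x) = (i == j).
Proof.
move=> /tnthP[k xk]; rewrite -leave_out_tupleE => /negP xj.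
have nj i : i != j -> tnth t i != x.
  move=> ij; apply/negP => /eqP tix; apply: xj.
  have [i' ii'] : exists i', i = lift j i'.
    by case: (unliftP j i) ij => [i' ->|->]; [exists i'|rewrite eqxx].
  by apply/tnthP; exists i'; rewrite tnth_mktuple -ii'.
move=> i; have [->|/nj/negPf//] := eqVneq i j.
have [<-|/nj] := eqVneq k j; first by rewrite -xk eqxx.
by rewrite -xk eqxx.
Qed.

End leave_one_out.

(** The norm bound with its exponent cleared, so that it can be compared with
    integrals. *)
Lemma Lnorm_leP d (T : measurableType d) (R : realType)
    (mu : {measure set T -> \bar R}) (q : nat) (f : T -> R) (g : R) :
    (0 < q)%N -> 0 <= g ->
  ('N[mu]_(q%:R%:E)[EFin \o f] <= g%:E)%E <->
  (\int[mu]_x (`|f x| ^+ q)%:E <= (g ^+ q)%:E)%E.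
Proof.
move=> q0 g0; have qn0 : q%:R != 0 :> R by rewrite pnatr_eq0 -lt0n.
rewrite Lnorm.unlock (_ : (\int[mu]_x _)%E = (\int[mu]_x (`|f x| ^+ q)%:E)%E); last first.
  by apply: eq_integral => x _; rewrite -powR_mulrn.
set I := (\int[mu]_x _)%E.
have I0 : (0 <= I)%E by apply: integral_ge0 => x _; rewrite lee_fin exprn_ge0.
have IE : I = ((I `^ q%:R^-1) `^ q%:R)%E by rewrite -poweRrM mulVf// poweRe1.
have gE : (g ^+ q)%:E = (g%:E `^ q%:R)%E by rewrite poweR_EFin powR_mulrn.
have gE' : g%:E = ((g ^+ q)%:E `^ q%:R^-1)%E.
  by rewrite gE -poweRrM mulfV// poweRe1// lee_fin.
split=> h.
  rewrite IE gE; apply: gt0_ler_poweR => //; rewrite ?in_itv/= ?leey ?andbT ?poweR_ge0//.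
rewrite gE'; apply: gt0_ler_poweR => //.
- by rewrite in_itv/= leey andbT.
- by rewrite in_itv/= leey andbT lee_fin exprn_ge0.
Qed.

(** * Stability of a poisoned pair *)

Section stability.
Context (R : realType) (dX dY dZ : measure_display).
Context (X : measurableType dX) (Y : measurableType dY) (Yh : measurableType dZ).
Context (psi : Yh -> Yh -> Y -> R) (B : R).
Context (psi_measurable :
  measurable_fun setT (fun w : Yh * Yh * Y => psi w.1.1 w.1.2 w.2)).
Context (psi_bounded : forall y' y'' y, - B <= psi y' y'' y <= B).

Lemma measurable_loo_diff (A0 A1 : algorithm R X Y Yh) n (j : 'I_n) :
  measurable_fun setT (@loo_diff _ _ _ _ _ _ _ psi n A0 A1 j).
Proof.
case: n j => [[]//|n] j; rewrite /loo_diff; apply: measurable_funB.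
  exact: measurable_compare_fit.
rewrite (_ : (fun w => _) = (fun w : (n.+1.-tuple (X * Y) * seed R) * (X * Y) =>
  compare psi (A0 (leave_out_tuple j w.1.1) w.1.2)
              (A1 (leave_out_tuple j w.1.1) w.1.2) w.2)); last first.
  by apply/funext => w; rewrite leave_out_tupleE.
apply: (measurableT_comp (measurable_compare_fit psi_measurable A0 A1 (m := n))
  (g := fun w : (n.+1.-tuple (X * Y) * seed R) * (X * Y) =>
    ((leave_out_tuple j w.1.1, w.1.2), w.2))).
apply: measurable_fun_pair => //; apply: measurable_fun_pair.
  apply: (measurableT_comp (measurable_leave_out j)).
  exact: (measurableT_comp measurable_fst measurable_fst).
exact: (measurableT_comp measurable_snd measurable_fst).
Qed.

Lemma normr_loo_diff_le (A0 A1 : algorithm R X Y Yh) n j w :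
  `|@loo_diff _ _ _ _ _ _ _ psi n A0 A1 j w| <= 2 * B.
Proof.
apply: le_trans (ler_normB _ _) _.
have h := normr_compare_le psi_bounded.
by rewrite mulr_natl mulr2n lerD.
Qed.

Context (P : probability (X * Y)%type R) (z : X * Y) (mz : measurable [set z]).
Context (a : {nonneg R}) (a1 : a%:num <= 1).
Context (A0 A1 : algorithm R X Y Yh) (f0 f1 : {mfun X >-> Yh}).

Let Pc : probability (X * Y)%type R := contaminated P z a1.
Let A0' := poisoned mz f0 A0.
Let A1' := poisoned mz f1 A1.

(** If [z] remains after the deletion, both fits are poisoned and nothing
    changes; if [z] was absent, the fits are the original ones. What is left is
    the single occurrence of [z] at the deleted position, and, when [z] is the
    test point, the crude bound [2 * B]. *)
Lemma loo_diff_poisoned_le n (j : 'I_n) q (w : (n.-tuple (X * Y) * seed R) * (X * Y)) :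
    (0 < q)%N ->
  `|loo_diff psi A0' A1' j w| ^+ q <=
  (if (z \in w.1.1) || (w.2 == z) then 0 else `|loo_diff psi A0 A1 j w| ^+ q) +
  ((2 * B) ^+ q * \1_([set t : n.-tuple (X * Y) | z \notin t] `*` setT `*` [set z]) w +
   (2 * B) ^+ q *
     \1_([set t : n.-tuple (X * Y) | forall i, (tnth t i == z) = (i == j)] `*` setT `*` setT) w).
Proof.
case: n j w => [[]//|n] j [[t xi] u] q0 /=.
have B0 : 0 <= (2 * B) ^+ q.
  by rewrite exprn_ge0//; exact: le_trans (normr_ge0 _) (normr_loo_diff_le A0 A1 j (t, xi, u)).
have bnd : `|loo_diff psi A0' A1' j (t, xi, u)| ^+ q <= (2 * B) ^+ q.
  by rewrite lerXn2r ?nnegrE// ?normr_loo_diff_le//;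
    exact: le_trans (normr_ge0 _) (normr_loo_diff_le A0 A1 j (t, xi, u)).
have ind0 (A : set ((n.+1.-tuple (X * Y) * seed R) * (X * Y))) v :
    0 <= (2 * B) ^+ q * \1_A v by rewrite mulr_ge0// indicE.
have [zt|zt] := boolP (z \in t) => /=.
  rewrite add0r; have [zj|zj] := boolP (z \in leave_out j t).
    rewrite /loo_diff /A0' /A1' /= /poisoned_fit zt zj subrr normr0 expr0n.
    by rewrite -[q == 0%N]negbK -lt0n q0/= addr_ge0.
  apply: le_trans bnd _; rewrite [X in _ <= _ + _ * X]indicE mem_set/=.
    by rewrite mulr1 lerDr.
  by split=> //; split=> //= i; exact: notin_leave_out.
have zj : z \notin leave_out j t by apply: contra zt; exact: mem_leave_out.
have -> : loo_diff psi A0' A1' j (t, xi, u) = loo_diff psi A0 A1 j (t, xi, u).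
  by rewrite /loo_diff /A0' /A1' /= /poisoned_fit (negbTE zt) (negbTE zj).
have [uz|uz] := eqVneq u z; last by rewrite lerDl addr_ge0.
rewrite add0r; apply: (@le_trans _ _ ((2 * B) ^+ q)).
  by rewrite lerXn2r ?nnegrE// ?normr_loo_diff_le//;
    exact: le_trans (normr_ge0 _) (normr_loo_diff_le A0 A1 j (t, xi, u)).
by rewrite [X in _ <= _ * X + _]indicE mem_set/= ?mulr1 ?lerDl.
Qed.

Lemma ge0_integral_contaminated_sample n
    (F : (n.-tuple (X * Y) * seed R) * (X * Y) -> \bar R) :
    measurable_fun setT F -> (forall w, 0 <= F w)%E ->
    (forall w, (z \in w.1.1) || (w.2 == z) -> F w = 0%E) ->
  (\int[((iid Pc n \x unif R) \x Pc)%E]_w F w =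
   (a%:num ^+ n.+1)%:E * \int[((iid P n \x unif R) \x P)%E]_w F w)%E.
Proof.
move=> mF F0 Fz.
have E (Q : probability (X * Y)%type R) :
    (\int[((iid Q n \x unif R) \x Q)%E]_w F w =
     \int[(iid Q n \x unif R)%E]_w \int[Q]_u F (w, u))%E.
  pose m1 : probability (n.-tuple (X * Y) * seed R)%type R := (iid Q n \x unif R)%E.
  exact: (@fubini_tonelli1 _ _ _ _ _ m1 Q F mF F0).
rewrite (E Pc) (E P).
have mc w : measurable_fun setT (fun u => F (w, u)).
  exact: measurableT_comp mF (measurable_pair1 w).
have mI : measurable_fun setT (fun w => \int[P]_u F (w, u))%E.
  exact: measurable_fun_fubini_tonelli_F.
under eq_integral => w _.
  rewrite ge0_integral_contaminated// (Fz (w, z)) ?eqxx ?orbT// mule0 adde0.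
  over.
rewrite ge0_integral_iid_contaminated_prod//.
- rewrite ge0_integralZl//; last by move=> w _; exact: integral_ge0.
  by rewrite muleA -EFinM exprSr.
- exact: measurable_funeM.
- by move=> w; rewrite mule_ge0// integral_ge0.
- move=> w zw; rewrite integral0_eq ?mule0// => u _; apply: Fz.
  by rewrite /= zw.
Qed.

Lemma contaminated_sample_box n (A : set (n.-tuple (X * Y))) (C : set (X * Y)) (s r : R) :
    measurable A -> measurable C -> iid Pc n A = s%:E -> Pc C = r%:E ->
  (((iid Pc n \x unif R) \x Pc) (A `*` setT `*` C) = (s * r)%:E)%E.
Proof.
move=> mA mC As Cr; pose m1 : probability (n.-tuple (X * Y) * seed R)%type R :=
  (iid Pc n \x unif R)%E.
have -> : (((iid Pc n \x unif R) \x Pc) (A `*` setT `*` C) = m1 (A `*` setT) * Pc C)%E.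
  by apply: (product_measure1E m1) => //; exact: measurableX.
have -> : (m1 (A `*` setT) = iid Pc n A * unif R setT)%E.
  by apply: product_measure1E.
by rewrite probability_setT mule1 As Cr.
Qed.

(** The three terms of [loo_diff_poisoned_le] integrate to
    at most [a ^+ n.+1] times the original instability and two box probabilities, and
    [perturbation_budget] adds them up. The factor [2] in the hypothesis on [B]
    counts these two boxes. *)
Lemma beta_poisoned (p g : R) (n q : nat) :
    (0 < q)%N -> 0 <= g -> 2 * (2 * B) ^+ q <= n%:R * g ^+ q ->
    P [set z] = p%:E -> 0 <= p <= 1 -> n%:R * p <= 1 - a%:num ->
  (beta psi P q n A0 A1 <= g%:E)%E -> (beta psi Pc q n A0' A1' <= g%:E)%E.
Proof.
move=> q0 g0 Bg Pz p01 np /bigmax_leP[_ hb].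
apply/bigmax_leP; split=> [|j _]; first exact: leNye.
apply/Lnorm_leP => //; have /Lnorm_leP hj := hb j isT.
have {hb hj} := hj q0 g0.
case: n j Bg np => [[]//|n] j Bg np.
set M := (_ \x P)%E => hM.
pose M' : probability ((n.+1.-tuple (X * Y) * seed R) * (X * Y))%type R :=
  ((iid Pc n.+1 \x unif R) \x Pc)%E.
set c := 1 - a%:num + a%:num * p.
have Pcz : Pc [set z] = c%:E.
  rewrite /Pc/= contaminatedE Pz diracE mem_set// mule1 -EFinM -EFinD.
  by rewrite addrC.
have Pcz' : Pc (~` [set z]) = (a%:num * (1 - p))%:E.
  by rewrite probability_setC// Pcz -EFinB /c; congr EFin; ring.
have a0 : 0 <= a%:num by [].
have mLD (B0 B1 : algorithm R X Y Yh) : measurable_fun setT (fun w =>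
    `|@loo_diff _ _ _ _ _ _ _ psi n.+1 B0 B1 j w| ^+ q).
  apply: measurable_funX.
  exact: (measurableT_comp (@normr_measurable R setT) (measurable_loo_diff B0 B1 j)).
pose S2 := [set t : n.+1.-tuple (X * Y) | z \notin t] `*` [set: seed R] `*` [set z].
pose S3 := [set t : n.+1.-tuple (X * Y) | forall i, (tnth t i == z) = (i == j)]
  `*` [set: seed R] `*` [set: X * Y].
pose G1 (w : (n.+1.-tuple (X * Y) * seed R) * (X * Y)) : R :=
  if (z \in w.1.1) || (w.2 == z) then 0 else `|loo_diff psi A0 A1 j w| ^+ q.
have mS2 : measurable S2.
  by apply: measurableX => //; apply: measurableX => //; exact: measurable_notin.
have mO : measurable [set t : n.+1.-tuple (X * Y) |
    forall i, (tnth t i == z) = (i == j)].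
  exact: measurable_once.
have mS3 : measurable S3 by apply: measurableX => //; exact: measurableX.
have mG1 : measurable_fun setT G1.
  apply: measurable_fun_ifT => //.
  apply: measurable_or.
    apply: (measurableT_comp (measurable_mem_tuple mz (n := n.+1))).
    exact: (measurableT_comp measurable_fst measurable_fst).
  apply: (measurable_fun_bool true); rewrite setTI.
  rewrite (_ : _ @^-1` _ = snd @^-1` [set z]); last first.
    by apply/seteqP; split=> w /= /eqP.
  by rewrite -[X in measurable X]setTI; exact: measurable_snd.
have B2 : 0 <= (2 * B) ^+ q.
  by rewrite exprn_ge0// mulr_ge0//;
    exact: le_trans (normr_ge0 _) (normr_compare_le psi_bounded f0 f1 z).
have G10 w : 0 <= G1 w by rewrite /G1; case: ifP => // _; rewrite exprn_ge0.
have mI S : measurable S -> measurable_fun setT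
    (fun w : (n.+1.-tuple (X * Y) * seed R) * (X * Y) => (2 * B) ^+ q * \1_S w).
  by move=> mS; apply: measurable_funM => //; exact: measurable_indic.
have I0 S (w : (n.+1.-tuple (X * Y) * seed R) * (X * Y)) :
    (0 <= ((2 * B) ^+ q * \1_S w)%:E)%E.
  by rewrite lee_fin mulr_ge0// indicE.
have IS S : measurable S ->
    (\int[M']_w ((2 * B) ^+ q * \1_S w)%:E = ((2 * B) ^+ q)%:E * M' S)%E.
  move=> mS; under eq_integral do rewrite EFinM.
  rewrite ge0_integralZl//.
  - by rewrite integral_indic// setIT.
  - by apply/measurable_EFinP; exact: measurable_indic.
apply: (@le_trans _ _ (\int[M']_w ((G1 w)%:E +
  (((2 * B) ^+ q * \1_S2 w)%:E + ((2 * B) ^+ q * \1_S3 w)%:E)))%E).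
  apply: ge0_le_integral => //.
  - by apply/measurable_EFinP; exact: (mLD A0' A1').
  - apply: emeasurable_funD; first exact/measurable_EFinP.
    by apply: emeasurable_funD; apply/measurable_EFinP; exact: mI.
  - by move=> w _; rewrite -!EFinD lee_fin; exact: loo_diff_poisoned_le.
have NE : iid Pc n.+1 [set t : n.+1.-tuple (X * Y) | z \notin t] =
    ((a%:num * (1 - p)) ^+ n.+1)%:E by exact: iid_notin.
have OE := iid_once mz j Pcz Pcz'.
have S2E : M' S2 = ((a%:num * (1 - p)) ^+ n.+1 * c)%:E.
  by apply: contaminated_sample_box => //; exact: measurable_notin.
have S3E : M' S3 = (c * (a%:num * (1 - p)) ^+ n.+1.-1 * 1)%:E.
  by apply: contaminated_sample_box => //; exact: probability_setT.
have G1E : (\int[M']_w (G1 w)%:E <= (a%:num ^+ n.+2 * g ^+ q)%:E)%E.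
  rewrite /M' ge0_integral_contaminated_sample//.
  - rewrite EFinM lee_wpmul2l ?lee_fin ?exprn_ge0//; apply: le_trans hM.
    apply: ge0_le_integral => //.
    + by move=> w _; rewrite lee_fin.
    + exact/measurable_EFinP.
    + by apply/measurable_EFinP; exact: (mLD A0 A1).
    + move=> w _; rewrite lee_fin /G1.
      by case: ifP => _; [rewrite exprn_ge0|exact: lexx].
  - exact/measurable_EFinP.
  - by move=> w zw; rewrite /G1 zw.
have mE f : measurable_fun setT f -> measurable_fun setT
    (fun w : (n.+1.-tuple (X * Y) * seed R) * (X * Y) => (f w)%:E) :=
  fun mf => (measurable_EFinP _ _).2 mf.
rewrite ge0_integralD//; last 4 first.
- by move=> w _; rewrite lee_fin.
- exact: mE.
- by move=> w _; rewrite adde_ge0.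
- by apply: emeasurable_funD; apply: mE; exact: mI.
rewrite ge0_integralD//; last 2 first.
- by apply: mE; exact: mI.
- by apply: mE; exact: mI.
rewrite IS// IS// S2E S3E -!EFinM -EFinD.
apply: (@le_trans _ _ ((a%:num ^+ n.+2 * g ^+ q)%:E +
  ((2 * B) ^+ q * ((a%:num * (1 - p)) ^+ n.+1 * c) +
   (2 * B) ^+ q * (c * (a%:num * (1 - p)) ^+ n.+1.-1 * 1))%:E)%E).
  by rewrite leeD2r.
rewrite -EFinD lee_fin.
rewrite mulr1 [_ * c]mulrC; apply: perturbation_budget => //.
- by rewrite a0.
- by rewrite exprn_ge0.
Qed.

End stability.

(** * The power bound *)

(** The seeds of the test are independent of the data, so only the law of the
    sample is contaminated. *)
Lemma reject_prob_contaminated (R : realType) (dX dY dZ : measure_display)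
    (X : measurableType dX) (Y : measurableType dY) (Yh : measurableType dZ)
    (nu : probability (seedseq R) R) (T : test R X Y Yh) (N : nat)
    (P : probability (X * Y)%type R) (z : X * Y) (a : {nonneg R}) (a1 : a%:num <= 1)
    (A0 A1 : algorithm R X Y Yh) : black_box T ->
  ((a%:num ^+ N)%:E * reject_prob nu T N P A0 A1 <=
   reject_prob nu T N (contaminated P z a1) A0 A1)%E.
Proof.
move=> [mT _].
pose S := [set w : N.-tuple (X * Y) * seedseq R | T A0 A1 w.1 w.2].
have mS : measurable S.
  by rewrite -[X in measurable X]setTI; exact: mT.
have IE (Q : probability (X * Y)%type R) :
    (\int[(iid Q N \x nu)%E]_w (\1_S w)%:E = reject_prob nu T N Q A0 A1)%E.
  by rewrite integral_indic// setIT.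
rewrite -!IE; apply: ge0_le_integral_iid_contaminated_prod.
  by apply/measurable_EFinP; exact: measurable_indic.
by move=> w; rewrite lee_fin indicE.
Qed.

Lemma exists_injective_sequence (T1 T2 : Type) (z0 : T1 * T2) :
    infinite_set [set: T1] \/ infinite_set [set: T2] ->
  exists z : nat -> T1 * T2, injective z.
Proof.
have inj (T : Type) : infinite_set [set: T] -> exists f : nat -> T, injective f.
  move=> /infiniteP/card_leP[f].
  exists (fun k => val (f (SigSub (mem_set (Logic.I : [set: nat] k))))).
  by move=> i j /val_inj/(@inj _ _ _ f) => /(_ (in_setT _) (in_setT _)) [].
case=> /inj[f finj].
  by exists (fun k => (f k, z0.2)) => i j [/finj].
by exists (fun k => (z0.1, f k)) => i j [/finj].
Qed.

Theorem theorem7 (R : realType) (dX dY dZ : measure_display)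
  (X : measurableType dX) (Y : measurableType dY) (Yh : measurableType dZ)
  (measurable_point : forall z : X * Y, measurable [set z])
  (nu : probability (seedseq R) R) (nu_iid : iid_unif nu)
  (q : nat) (hq : q = 1%N \/ q = 2%N)
  (alpha : R) (halpha : 0 < alpha < 1)
  (n N : nat) (hn : (1 <= n)%N) (hN : (1 <= N)%N)
  (psi : Yh -> Yh -> Y -> R)
  (psi_measurable :
    measurable_fun setT (fun w : Yh * Yh * Y => psi w.1.1 w.1.2 w.2))
  (psi_anti : forall (y' y'' : Yh) (y : Y), psi y' y'' y = - psi y'' y' y)
  (hinf : infinite_set [set: X] \/ infinite_set [set: Y])
  (B : R) (psi_bounded : forall (y' y'' : Yh) (y : Y), - B <= psi y' y'' y <= B)
  (T : test R X Y Yh) (T_black_box : black_box T)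
  (gamma : R) (hgamma : 4 * B / n%:R `^ (q%:R^-1) <= gamma)
  (T_valid : forall (A0 A1 : algorithm R X Y Yh) (P : probability (X * Y)%type R),
    (beta psi P q n A0 A1 <= gamma%:E)%E ->
    Delta_alg psi P n A0 A1 <= 0 ->
    (reject_prob nu T N P A0 A1 <= alpha%:E)%E)
  (A0 A1 : algorithm R X Y Yh) (P : probability (X * Y)%type R)
  (hbeta : (beta psi P q n A0 A1 <= gamma%:E)%E)
  (hDelta : 0 < Delta_alg psi P n A0 A1)
  (hmax : B * (alpha^-1 - 1) / N%:R < Delta_max psi P) :
  (reject_prob nu T N P A0 A1 <=
    (Num.min
      (alpha *
        (1 + (Delta_alg psi P n A0 A1 + B * (alpha^-1 - 1) / N%:R) /
             (Delta_max psi P - B * (alpha^-1 - 1) / N%:R))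
        `^ (N%:R / n%:R))
      1)%:E)%E.
Proof.
have /andP[alpha0 alpha1] := halpha.
have N0 : 0 < N%:R :> R by rewrite ltr0n.
have n0 : 0 < n%:R :> R by rewrite ltr0n.
have q0 : (0 < q)%N by case: hq => ->.
have [z0 _] : [set: X * Y] !=set0.
  apply/set0P/negP => /eqP XY0; have := probability_setT P.
  by rewrite XY0 measure0 => /eqP; rewrite eq_sym onee_eq0.
have B0 : 0 <= B.
  have f := A0 [::] (unit_interval0 R).
  exact: le_trans (normr_ge0 _) (normr_compare_le psi_bounded f f z0).
have g0 : 0 <= gamma by apply: le_trans hgamma; rewrite divr_ge0 ?powR_ge0// mulr_ge0.
have hgq : 2 * (2 * B) ^+ q <= n%:R * gamma ^+ q.
  have : (4 * B) ^+ q <= n%:R * gamma ^+ q.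
    have : (4 * B / n%:R `^ q%:R^-1) ^+ q <= gamma ^+ q.
      by rewrite lerXn2r// nnegrE divr_ge0 ?powR_ge0// mulr_ge0.
    rewrite expr_div_n -[(n%:R `^ _) ^+ q]powR_mulrn ?powR_ge0// -powRrM.
    by rewrite mulVf ?pnatr_eq0 -?lt0n// powRr1// ler_pdivrMr// [_ * n%:R]mulrC.
  apply: le_trans.
  have BB : 0 <= B ^+ 2 by rewrite exprn_ge0.
  (* [2 * 2 ^+ q <= 4 ^+ q] because [q] is positive. *)
  by case: hq => ->; rewrite ?expr1 ?exprMn; lra.
set D_A := Delta_alg psi P n A0 A1 in hDelta *.
set b := B * (alpha^-1 - 1) / N%:R in hmax *.
set D := Delta_max psi P in hmax *.
set rho := 1 + _ / _.
have b0 : 0 <= b.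
  by rewrite divr_ge0// mulr_ge0// subr_ge0 invf_ge1// ltW.
have den0 : 0 < D - b by rewrite subr_gt0.
have rho1 : 1 < rho by rewrite ltrDl divr_gt0// ltr_pwDl.
pose mu : probability (N.-tuple (X * Y) * seedseq R)%type R := (iid P N \x nu)%E.
have mT (C0 C1 : algorithm R X Y Yh) :
    measurable [set w : N.-tuple (X * Y) * seedseq R | T C0 C1 w.1 w.2].
  by rewrite -[X in measurable X]setTI; exact: T_black_box.1.
have rej_fin C0 C1 : exists s : R, reject_prob nu T N P C0 C1 = s%:E.
  exists (fine (reject_prob nu T N P C0 C1)); rewrite fineK//.
  exact: (fin_num_measure mu _ (mT C0 C1)).
have [r rE] := rej_fin A0 A1.
have r1 : r <= 1.
  by rewrite -lee_fin -rE; exact: (probability_le1 mu (mT A0 A1)).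
rewrite rE lee_fin le_min r1 andbT leNgt; apply/negP => big.
have [a [/andP[a0 a1] an aN]] := exists_retention alpha0 rho1 hn hN big.
(* This is where [B * (alpha^-1 - 1) / N] enters: [alpha < a ^+ N] and Bernoulli's
   inequality bound the odds [(1 - a) / a]. *)
have aB : (1 - a) * B <= a * b.
  have aNinv : a^-1 ^+ N <= alpha^-1.
    rewrite exprVn lef_pV2 ?posrE ?exprn_gt0//; apply: le_trans (ltW aN) _.
    by rewrite ler_piMr// exprn_ge0// ltW.
  have ai0 : 0 <= a^-1 - 1 by rewrite subr_ge0 invf_ge1// ltW.
  have := @bernoulli _ (a^-1 - 1) N; rewrite (le_trans _ ai0) ?lerN10//.
  move=> /(_ isT); rewrite [1 + (_ - 1)]addrC subrK => ber.
  have aib : B * (a^-1 - 1) <= b.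
    rewrite /b -mulrA ler_wpM2l// ler_pdivlMr// [_ * N%:R]mulrC.
    by rewrite lerBrDl; exact: le_trans aNinv.
  rewrite (_ : (1 - a) * B = a * (B * (a^-1 - 1))).
    by rewrite ler_wpM2l// ltW.
  by field; rewrite gt_eqF.
have an1 : a ^+ n < 1 by rewrite exprn_ilt1// ?ltW// -lt0n.
(* A pair of models with a risk gap above this threshold, used as poison, makes
   the average risk gap under contamination negative. *)
pose threshold := (a ^+ n * D_A + b) / (1 - a ^+ n).
have threshold_lt : threshold < D.
  rewrite ltr_pdivrMr ?subr_gt0//.
  have : a ^+ n * (D_A + D) < D - b.
    have rhoE : rho * (D - b) = D_A + D.
      by rewrite mulrDl mul1r divfK ?gt_eqF//; ring.
    by rewrite -rhoE mulrA gtr_pMl.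
  lra.
have [_ [f0 _ [f1 _ <-]] Df] : exists2 y, [set Delta psi P f0 f1 |
    f0 in [set: {mfun X >-> Yh}] & f1 in [set: {mfun X >-> Yh}]] y & threshold < y.
  apply: sup_gt threshold_lt; have f := A0 [::] (unit_interval0 R).
  by exists (Delta psi P f f); exists f => //; exists f.
set Df01 := Delta psi P f0 f1 in Df.
have slack0 : 0 < Df01 * (1 - a ^+ n) - a ^+ n * D_A - b.
  by move: Df; rewrite ltr_pdivrMr ?subr_gt0//; lra.
set slack := _ - b in slack0.
have Df0 : 0 <= Df01.
  apply: le_trans (ltW Df); rewrite divr_ge0 ?subr_ge0 ?(ltW an1)//.
  by rewrite addr_ge0// mulr_ge0 ?exprn_ge0// ltW.
(* Mass of the poisoned point that both the stability budget and the slack in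
   the risk can absorb; [B + 1] avoids a division by zero. *)
pose eta := Num.min ((1 - a) / n%:R) (slack / (n%:R * (B + 1))).
have eta0 : 0 < eta.
  rewrite lt_min; apply/andP; split; rewrite divr_gt0// ?subr_gt0//.
  by rewrite mulr_gt0// ltr_wpDl.
have [z zinj] := exists_injective_sequence z0 hinf.
pose A0' k := poisoned (measurable_point (z k)) f1 A0.
pose A1' k := poisoned (measurable_point (z k)) f0 A1.
have near_reject : \forall k \near \oo,
    ((alpha / a ^+ N)%:E < reject_prob nu T N P (A0' k) (A1' k))%E.
  apply: (near_lt_measure (mu := mu)
    (S := [set w : N.-tuple (X * Y) * seedseq R | T A0 A1 w.1 w.2])) => //.
    move=> w /= Tw.
    have [K _ TK] := black_box_poisoned A0 A1 w.1 w.2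
      (fun k => measurable_point (z k)) f1 f0 T_black_box zinj.
    by exists K => // k /TK /= ->.
  rewrite [X in (_ < X)%E](_ : _ = r%:E); last exact: rE.
  rewrite lte_fin ltr_pdivrMr ?exprn_gt0//.
  by rewrite mulrC.
have near_light : \forall k \near \oo, ((1 - eta)%:E < P (~` [set z k]))%E.
  apply: (near_lt_measure (S := setT)) => //.
  - by move=> k; exact: measurableC.
  - move=> x _; have [[k0 zk0]|nx] := pselect (exists k, z k = x); last first.
      by exists 0%N => // k _ /= xk; apply: nx; exists k.
    exists k0.+1 => // k /= k0k; rewrite -zk0 => /zinj kk.
    by rewrite kk ltnn in k0k.
  - rewrite [X in (_ < X)%E](_ : _ = 1%E); last exact: (probability_setT P).
    by rewrite lte_fin ltrBlDr ltrDl.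
have [k [Rk Lk]] : exists k,
    ((alpha / a ^+ N)%:E < reject_prob nu T N P (A0' k) (A1' k))%E /\
    ((1 - eta)%:E < P (~` [set z k]))%E.
  have [K1 _ h1] := near_reject; have [K2 _ h2] := near_light.
  exists (maxn K1 K2); split; [apply: h1|apply: h2] => /=.
    exact: leq_maxl.
  exact: leq_maxr.
have [p pE] : exists p : R, P [set z k] = p%:E.
  by exists (fine (P [set z k])); rewrite fineK// fin_num_measure.
have pE' : P (~` [set z k]) = (1 - p)%:E by rewrite probability_setC// pE.
have p01 : 0 <= p <= 1 by rewrite -!lee_fin -pE measure_ge0 probability_le1.
have peta : p < eta by move: Lk; rewrite pE' lte_fin; lra.
have np : n%:R * p <= 1 - a.
  have : p < (1 - a) / n%:R by apply: lt_le_trans peta _; rewrite ge_min lexx.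
  by rewrite ltr_pdivlMr// mulrC => /ltW.
have Bnp : B * (n%:R * p) <= slack.
  have : p < slack / (n%:R * (B + 1)).
    by apply: lt_le_trans peta _; rewrite ge_min lexx orbT.
  rewrite ltr_pdivlMr; last by rewrite mulr_gt0// ltr_wpDl.
  have : 0 <= n%:R * p by rewrite mulr_ge0//; case/andP: p01.
  nra.
pose ann : {nonneg R} := NngNum (ltW a0).
have a1' : ann%:num <= 1 by exact: ltW.
have valid := T_valid (A0' k) (A1' k) (contaminated P (z k) a1').
have : ((a ^+ N)%:E * reject_prob nu T N P (A0' k) (A1' k) <= alpha%:E)%E.
  apply: le_trans (reject_prob_contaminated nu N P (z k) a1' _ _ T_black_box) _.
  apply: valid.
    exact: (beta_poisoned psi_measurable psi_bounded (measurable_point (z k))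
      a1' f1 f0 q0 g0 hgq pE p01 np hbeta).
  apply: le_trans (Delta_alg_poisoned psi_measurable psi_bounded
    (measurable_point (z k)) a1' _ A0 A1 psi_anti Df0 pE' p01) _.
  have an0 : 0 <= a ^+ n by rewrite exprn_ge0// ltW.
  have aBnp : a ^+ n * (B * (n%:R * p)) <= slack.
    apply: le_trans Bnp; rewrite ler_piMl ?(ltW an1)// !mulr_ge0//.
    by case/andP: p01.
  rewrite exprS -/D_A -/Df01 /=.
  have : a * (a ^+ n * (B * (n%:R * p))) <= a * slack by rewrite ler_wpM2l// ltW.
  by rewrite /slack; nra.
have [s sE] := rej_fin (A0' k) (A1' k).
move: Rk; rewrite sE lte_fin ltr_pdivrMr ?exprn_gt0// -EFinM lee_fin => Rk.
by rewrite leNgt [_ * s]mulrC Rk.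
Qed.
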